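(* Let $c>0$, $\ell\ge 1$, let $y_n\in\{+1,-1\}$ and let $\tilde{\mathbf x}_n$ be the random corrupted feature vectors in $\mathbb R^D$, $n=1,\dots,N$. For $\mathbf w\in\mathbb R^D$ write $\zeta_n(\mathbf w)=\ell-y_n\mathbf w^\top\tilde{\mathbf x}_n$. Fix a current parameter $\bar{\mathbf w}\in\mathbb R^D$ with $\mathbb E_p[\zeta_n(\bar{\mathbf w})^2]>0$ for all $n$, and let $q(\boldsymbol\lambda)=\prod_{n=1}^N q(\lambda_n)$ with $$q(\lambda_n)=\mathcal{GIG}\Big(\lambda_n;\tfrac12,1,c^2\,\mathbb E_p[\zeta_n(\bar{\mathbf w})^2]\Big),\qquad \gamma_n:=\mathbb E_q[\lambda_n^{-1}].$$ Then the M-step, i.e. the minimization over $\mathbf w\in\mathbb R^D$ of $$\|\mathbf w\|_2^2+\sum_{n=1}^N\mathbb E_p\Big[c\,\zeta_n(\mathbf w)+\frac{c^2}{2}\gamma_n\,\zeta_n(\mathbf w)^2\Big],$$ is equivalent to (has the same minimizers as) the minimization over $\mathbf w\in\mathbb R^D$ of the $\ell_2$-regularized re-weighted quadratic loss $$\|\mathbf w\|_2^2+\frac{c^2}{2}\sum_{n=1}^N\gamma_n\,\mathbb E_p\big[(\mathbf w^\top\tilde{\mathbf x}_n-y_n^h)^2\big],\qquad y_n^h:=\Big(\ell+\frac{1}{c\gamma_n}\Big)y_n,$$ and the re-weights are given in closed form by $$\gamma_n=\frac{1}{c\sqrt{\mathbb E_p[\zeta_n(\bar{\mathbf w})^2]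}}.$$
   Context: Data: $(\mathbf x_n,y_n)$, $n=1,\dots,N$, with $\mathbf x_n\in\mathbb R^D$. Each $\tilde{\mathbf x}_n$ is a random vector in $\mathbb R^D$, drawn from a corrupting distribution $p(\tilde{\mathbf x}_n\mid\mathbf x_n)=\prod_{d=1}^D p(\tilde x_{nd}\mid x_{nd})$ with independent coordinates, finite second moments and $\mathbb E_p[\tilde{\mathbf x}_n]=\mathbf x_n$. $\mathbb E_p$ denotes expectation under the corrupting distribution, $\mathbb E_q$ expectation under $q(\boldsymbol\lambda)$. Any offset of the linear classifier is ignored (or absorbed into $\mathbf w$). $\mathcal{GIG}(x;p,a,b)$ denotes the generalized inverse Gaussian distribution on $(0,\infty)$ with density proportional to $x^{p-1}\exp\big(-\tfrac12(\tfrac bx+ax)\big)$. *)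

(* Defs.v *)
From mathcomp Require Import all_boot all_order all_algebra.
From mathcomp Require Import all_classical all_reals all_analysis.

Set Implicit Arguments.
Unset Strict Implicit.
Unset Printing Implicit Defensive.

Import Order.TTheory GRing.Theory Num.Theory.
Import numFieldNormedType.Exports.

Local Open Scope classical_set_scope.
Local Open Scope ring_scope.

Definition dotv (R : realType) (D : nat) (u v : 'rV[R]_D) : R :=
  \sum_(d < D) u 0 d * v 0 d.

(* The library norm `|w| on matrices is the sup norm; the Euclidean norm is
   written out. *)
Definition sqnorm2 (R : realType) (D : nat) (w : 'rV[R]_D) : R :=
  \sum_(d < D) w 0 d ^+ 2.

(* Random vectors take values in D.-tuple R, which carries the product
   sigma-algebra; rvec views such a value as a row vector. *)
Definition rvec (R : realType) (D : nat) (t : D.-tuple R) : 'rV[R]_D :=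
  \row_d tnth t d.

(* mu is the product of the nu i: its value on every measurable box is the
   product of the one-dimensional values (this determines mu, the boxes being
   a pi-system generating the product sigma-algebra). *)
Definition is_product_law (R : realType) (m : nat)
    (mu : set (m.-tuple R) -> \bar R) (nu : 'I_m -> set R -> \bar R) : Prop :=
  forall B : 'I_m -> set R, (forall i, measurable (B i)) ->
    mu [set t | forall i, B i (tnth t i)] = (\prod_(i < m) nu i (B i))%E.

Section generalized_inverse_gaussian.
Context (R : realType) (p a b : R).

Definition gig_fun (x : R) : R :=
  x `^ (p - 1) * expR (- (2^-1 * (b / x + a * x))).

(* For a, b > 0 the integral is positive and finite; `fine` only changes the
   type. *)
Definition gig_norm : R :=
  fine (\int[lebesgue_measure]_(x in `]0%R, +oo[) (gig_fun x)%:E)%E.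

Definition gig_pdf (x : R) : R := (gig_fun \_ `]0, +oo[) x / gig_norm.

Definition gig_prob (U : set R) : \bar R :=
  (\int[lebesgue_measure]_(x in U) (gig_pdf x)%:E)%E.

End generalized_inverse_gaussian.

Definition zeta (R : realType) (D : nat) (l y : R) (w v : 'rV[R]_D) : R :=
  l - y * dotv w v.

Definition is_minimizer (R : realType) (W : Type) (F : W -> \bar R) (w : W) :
  Prop := forall w', (F w <= F w')%E.

(* Main.v *)
Require Import Defs.
From HB Require Import structures.
From mathcomp Require Import all_boot all_order all_algebra.
From mathcomp Require Import all_classical all_reals all_analysis.
From mathcomp Require Import measurable_realfun.
From mathcomp Require Import ring lra.

Set Implicit Arguments.
Unset Strict Implicit.
Unset Printing Implicit Defensive.

Import Order.TTheory GRing.Theory Num.Theory.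
Import numFieldNormedType.Exports.

Local Open Scope classical_set_scope.
Local Open Scope ring_scope.

(** Since [y ^+ 2 = 1], completing the square in [zeta] turns the M-step
    integrand into [c ^+ 2 / 2 * gamma * (w.x - yh) ^+ 2 - 1 / (2 * gamma)]; the
    last term does not depend on [w], so both objectives, finite because of the
    second moments, differ by a constant.

    For the weights, let [g] be the unnormalized GIG density with parameters
    [1/2], [1], [b].  It satisfies [g (b / x) / x = g x / sqrt b], so the
    substitution [x |-> b / x], which preserves the half-line, gives
    [\int g x / x = (\int g x) / sqrt b]: the mean of [1 / lambda] is
    [1 / sqrt b], and the normalizing constant is never computed. *)

(** * The substitution [x |-> b / x] on the half-line *)

Lemma is_derive_div (R : realType) (b x : R) : x != 0 ->
  is_derive x 1 (fun u : R => b / u) (- (b / x ^+ 2)).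
Proof.
move=> x0; have dV : derivable (fun u : R => u^-1) x 1 by exact: derivableV.
have -> : - (b / x ^+ 2) = 'D_1 (fun u : R => b / u) x.
  rewrite (_ : (fun u : R => b / u) = b *: (fun u : R => u^-1))//.
  by rewrite deriveZ// deriveV// derive_id /GRing.scale/= mulr1 mulrN.
by apply: derivableP; exact: derivableM.
Qed.

Lemma continuous_itv0y_cc (R : realType) (G : R -> R) (a b : R) :
  0 < a -> {in `]0, +oo[, continuous G} -> {within `[a, b], continuous G}.
Proof.
move=> a0 cG; apply: continuous_in_subspaceT => x /[!inE]/=.
rewrite in_itv/= => /andP[ax _]; apply: cG.
by rewrite in_itv/= andbT (lt_le_trans a0).
Qed.

Section reflection.
Context (R : realType).
Notation mu := (@lebesgue_measure R).

(* [x |-> s ^+ 2 / x] reverses the interval [[s / r, s * r]]. *)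
Lemma integral_div_itvcc (G : R -> R) (s r : R) : 0 < s -> 1 <= r ->
  {in `]0, +oo[, continuous G} ->
  (\int[mu]_(x in `[(s / r)%R, (s * r)%R]) (G x)%:E =
   \int[mu]_(x in `[(s / r)%R, (s * r)%R])
     (G (s ^+ 2 / x) * (s ^+ 2 / x ^+ 2))%R%:E)%E.
Proof.
move=> s0 r1 cG; have r0 : 0 < r by exact: lt_le_trans r1.
have sr0 : 0 < s / r by exact: divr_gt0.
have sr0' : 0 < s * r by exact: mulr_gt0.
have srsr : s / r <= s * r.
  by rewrite ler_pM2l// (le_trans _ r1)// invf_le1.
have s20 : 0 < s ^+ 2 by rewrite exprn_gt0.
pose F (x : R) := s ^+ 2 / x.
have F1 : s / r = F (s * r) by rewrite /F; field; rewrite !gt_eqF.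
have F2 : s * r = F (s / r) by rewrite /F; field; rewrite !gt_eqF.
have dF (x : R) : 0 < x -> is_derive x 1 F (- (s ^+ 2 / x ^+ 2)).
  by move=> x0; apply: is_derive_div; rewrite gt_eqF.
have F'E (x : R) : 0 < x -> F^`()%classic x = - (s ^+ 2 / x ^+ 2).
  by move=> /dF ?; rewrite derive1E derive_val.
have cF' (x : R) : 0 < x -> {for x, continuous F^`()%classic}.
  move=> x0; have : (fun x : R => - (s ^+ 2 / x ^+ 2)) y @[y --> x] -->
      (fun x : R => - (s ^+ 2 / x ^+ 2)) x.
    apply: cvgN; apply: cvgM; first exact: cvg_cst.
    apply: cvgV; first by rewrite expf_neq0// gt_eqF.
    exact: exprn_continuous.
  (* The formula for [F'] is known at positive points only, but these form a neighbourhood of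
     [x]. *)
  rewrite /continuous_at -F'E//; apply: cvg_trans; apply: near_eq_cvg.
  near=> y; rewrite F'E//; near: y; exact: lt_nbhsr.
have cF (x : R) : 0 < x -> {for x, continuous F}.
  by move=> /dF [? _]; apply/differentiable_continuous/derivable1_diffP.
have := @integration_by_substitution_decreasing R F G (s / r) (s * r) srsr.
rewrite -F1 -F2 => ->.
(* A decreasing substitution contributes the factor [- F'], here the positive [s ^+ 2 / x ^+ 2]. *)
- apply: eq_integral => x; rewrite inE/= in_itv/= => /andP[sx _].
  by rewrite /= !fctE F'E ?opprK// (lt_le_trans sr0).
- move=> x y; rewrite !in_itv/= => /andP[sx _] /andP[sy _] xy.
  have x0 := lt_le_trans sr0 sx; have y0 := lt_le_trans sr0 sy.
  by rewrite /F ltr_pM2l// ltf_pV2.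
- move=> x; rewrite in_itv/= => /andP[sx _]; apply: cF'; exact: lt_trans sx.
- by apply: cvgP; apply: cvg_at_right_filter; exact: cF'.
- by apply: cvgP; apply: cvg_at_left_filter; exact: cF'.
- split.
  + by move=> x; rewrite in_itv/= => /andP[sx _]; case: (dF x) => //;
      exact: lt_trans sx.
  + by apply: cvg_at_right_filter; exact: cF.
  + by apply: cvg_at_left_filter; exact: cF.
- exact: continuous_itv0y_cc.
Unshelve. all: end_near. Qed.

(** Monotone convergence along an exhaustion of the half-line. The intervals are chosen so that
    [x |-> s ^+ 2 / x] maps each one onto itself. *)
Lemma cvg_integral_itv0y (G : R -> R) (s : R) : 0 < s ->
  measurable_fun `](0 : R), +oo[ G -> {in `]0, +oo[, forall x, 0 <= G x} ->
  ((\int[mu]_(x in `[(s / k.+1%:R)%R, (s * k.+1%:R)%R]) (G x)%:E)%E @[k --> \oo]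
   --> (\int[mu]_(x in `]0%R, +oo[) (G x)%:E)%E).
Proof.
move=> s0 mG G0.
pose K (k : nat) : set R := `[s / k.+1%:R, s * k.+1%:R]%classic.
have K0 k : K k `<=` `]0, +oo[.
  move=> x /=; rewrite /K/= !in_itv/= => /andP[+ _]; rewrite andbT.
  by apply: lt_le_trans; rewrite divr_gt0.
have -> : `]0, +oo[%classic = \bigcup_k K k.
  apply/seteqP; split=> [x|x [k _ /K0]//].
  rewrite /= in_itv/= andbT => x0.
  (* A single bound for both ratios: [s / x <= k.+1] places [x] above the left endpoint,
     [x / s <= k.+1] below the right one. *)
  exists (Num.bound (s / x + x / s)) => //; rewrite /K/= in_itv/=.
  have sx0 : 0 < s / x by exact: divr_gt0.
  have xs0 : 0 < x / s by exact: divr_gt0.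
  have := archi_boundP (ltW (addr_gt0 sx0 xs0)).
  set m := Num.bound _ => h.
  have m1 : m%:R <= m.+1%:R :> R by rewrite ler_nat.
  have m0 : 0 < m.+1%:R :> R by [].
  apply/andP; split.
    by rewrite ler_pdivrMr// -ler_pdivrMl// mulrC; lra.
  by rewrite -ler_pdivrMl// mulrC; lra.
apply: ge0_nondecreasing_set_cvg_integral.
- apply/nondecreasing_seqP => k; apply/subsetPset => x.
  rewrite /K/= !in_itv/= => /andP[h1 h2]; apply/andP; split.
    apply: le_trans h1; rewrite ler_pM2l// lef_pV2 ?posrE//.
    by rewrite ler_nat.
  by apply: (le_trans h2); rewrite ler_pM2l// ler_nat.
- by move=> k; exact: measurable_itv.
- move=> k; apply/measurable_EFinP; apply: measurable_funS mG => //.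
  exact: K0.
- by move=> k x /K0 Kx; rewrite lee_fin G0.
Qed.

Lemma measurable_fun_itv0y (G : R -> R) :
  {in `]0, +oo[, continuous G} -> measurable_fun `](0 : R), +oo[ G.
Proof.
move=> cG; apply: open_continuous_measurable_fun; first exact: interval_open.
by move=> x; rewrite inE/=; exact: cG.
Qed.

(** For [s = sqrt b], the fixed point of the substitution, the truncated integrals of both sides
    coincide on every interval of the exhaustion, hence so do their limits. *)
Lemma integral_div_itv0y (G : R -> R) (b : R) : 0 < b ->
  {in `]0, +oo[, continuous G} -> {in `]0, +oo[, forall x, 0 <= G x} ->
  (\int[mu]_(x in `]0%R, +oo[) (G x)%:E =
   \int[mu]_(x in `]0%R, +oo[) (G (b / x) * (b / x ^+ 2))%R%:E)%E.
Proof.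
move=> b0 cG G0; pose s := Num.sqrt b.
have s0 : 0 < s by rewrite sqrtr_gt0.
have bE : b = s ^+ 2 by rewrite sqr_sqrtr// ltW.
have cdiv (x : R) : 0 < x -> {for x, continuous (fun u : R => b / u)}.
  move=> x0; apply/differentiable_continuous/derivable1_diffP.
  by case: (is_derive_div b (lt0r_neq0 x0)).
have mH : measurable_fun `](0 : R), +oo[
    (fun x : R => G (b / x) * (b / x ^+ 2)).
  apply: measurable_fun_itv0y => x; rewrite in_itv/= andbT => x0.
  apply: cvgM.
    apply: (@continuous_comp _ _ _ (fun u : R => b / u) G); first exact: cdiv.
    by apply: cG; rewrite in_itv/= andbT divr_gt0.
  apply: cvgM; first exact: cvg_cst.
  apply: cvgV; first by rewrite expf_neq0// gt_eqF.
  exact: exprn_continuous.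
have h1 := cvg_integral_itv0y s0 (measurable_fun_itv0y cG) G0.
apply: (cvg_unique _ h1); first exact: ereal_hausdorff.
have -> : (fun k : nat => \int[mu]_(x in `[(s / k.+1%:R)%R, (s * k.+1%:R)%R])
       (G x)%:E)%E =
    (fun k : nat => \int[mu]_(x in `[(s / k.+1%:R)%R, (s * k.+1%:R)%R])
       (G (b / x) * (b / x ^+ 2))%R%:E)%E.
  by apply/funext => k; rewrite bE integral_div_itvcc// ler1n.
apply: (@cvg_integral_itv0y (fun x : R => G (b / x) * (b / x ^+ 2))) => //.
move=> x; rewrite in_itv/= andbT => x0.
rewrite mulr_ge0// ?G0// ?in_itv/= ?andbT ?divr_gt0//.
by rewrite ltW// divr_gt0// exprn_gt0.
Qed.

End reflection.

(** * The generalized inverse Gaussian law of index 1/2: total mass and mean of the inverse *)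

Section gig.
Context (R : realType).
Notation mu := (@lebesgue_measure R).

Lemma gig_fun_half (b x : R) : 0 < x ->
  gig_fun 2^-1 1 b x = (Num.sqrt x)^-1 * expR (- (2^-1 * (b / x + x))).
Proof.
move=> x0; rewrite /gig_fun mul1r; congr (_ * _).
have -> : 2^-1 - 1 = - 2^-1 :> R by field.
by rewrite powRN powR12_sqrt// ltW.
Qed.

Lemma gig_fun_ge0 (p a b x : R) : 0 <= gig_fun p a b x.
Proof. by rewrite mulr_ge0 ?powR_ge0// expR_ge0. Qed.

Lemma gig_fun_half_gt0 (b x : R) : 0 < x -> 0 < gig_fun 2^-1 1 b x.
Proof.
by move=> x0; rewrite gig_fun_half// mulr_gt0 ?expR_gt0// invr_gt0 sqrtr_gt0.
Qed.

(** The exponent [b / x + x] is invariant under [x |-> b / x], so only the power factor changes. The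
    index 1/2 is what makes [(b / x) ^ (p - 1) / x] proportional to [x ^ (p - 1)] again. *)
Lemma gig_fun_half_div (b x : R) : 0 < b -> 0 < x ->
  gig_fun 2^-1 1 b (b / x) / x = (Num.sqrt b)^-1 * gig_fun 2^-1 1 b x.
Proof.
move=> b0 x0; rewrite !gig_fun_half ?divr_gt0//.
have -> : b / (b / x) + b / x = b / x + x by field; rewrite !gt_eqF.
(* Once the divisor [x] is the square of its root, the identity is rational in the two roots. *)
rewrite sqrtrM ?sqrtrV ?ltW// -[in X in _ / X](sqr_sqrtr (ltW x0)).
by field; rewrite !gt_eqF// sqrtr_gt0.
Qed.

Lemma continuous_gig_fun_half (b : R) :
  {in `]0, +oo[, continuous (gig_fun 2^-1 1 b)}.
Proof.
move=> x; rewrite in_itv/= andbT => x0.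
have cf : {for x, continuous
    (fun u : R => (Num.sqrt u)^-1 * expR (- (2^-1 * (b / u + u))))}.
  apply: (@continuousM R R); first apply: continuousV.
  - by rewrite lt0r_neq0// sqrtr_gt0.
  - exact: sqrt_continuous.
  apply: continuous_comp; last exact: continuous_expR.
  apply: continuousN; apply: continuousM; first exact: cst_continuous.
  apply: continuousD => //; apply: continuousM; first exact: cst_continuous.
  by apply: inv_continuous; rewrite lt0r_neq0.
rewrite /continuous_at gig_fun_half//; apply: cvg_trans cf.
apply: near_eq_cvg; near=> y; rewrite gig_fun_half//; near: y.
exact: lt_nbhsr.
Unshelve. all: end_near. Qed.

Lemma measurable_gig_fun_half (b : R) :
  measurable_fun `](0 : R), +oo[ (gig_fun 2^-1 1 b).
Proof. by apply: measurable_fun_itv0y; exact: continuous_gig_fun_half. Qed.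

Lemma continuous_gig_fun_half_div (b : R) :
  {in `]0, +oo[, continuous (fun x : R => x^-1 * gig_fun 2^-1 1 b x)}.
Proof.
move=> x x0; apply: (@continuousM R R); last exact: continuous_gig_fun_half.
by apply: inv_continuous; move: x0; rewrite in_itv/= andbT => /lt0r_neq0.
Qed.

(** Under the substitution [x^-1] becomes [x / b], which meets the Jacobian [b / x ^+ 2] to leave
    [1 / x]; the reflection identity then replaces [g (b / x) / x] by [g x / sqrt b]. *)
Lemma integral_inv_gig_fun_half (b : R) : 0 < b ->
  (\int[mu]_(x in `]0%R, +oo[) (x^-1 * gig_fun 2^-1 1 b x)%R%:E =
   ((Num.sqrt b)^-1)%:E *
     \int[mu]_(x in `]0%R, +oo[) (gig_fun 2^-1 1 b x)%:E)%E.
Proof.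
move=> b0.
rewrite (@integral_div_itv0y R (fun x => x^-1 * gig_fun 2^-1 1 b x) b)//;
  last 2 first.
- exact: continuous_gig_fun_half_div.
- move=> x; rewrite in_itv/= andbT => x0.
  by rewrite mulr_ge0 ?gig_fun_ge0// invr_ge0 ltW.
rewrite -ge0_integralZl//; last 2 first.
- by apply/measurable_EFinP; exact: measurable_gig_fun_half.
- by move=> x _; rewrite lee_fin gig_fun_ge0.
apply: eq_integral => x; rewrite inE/= in_itv/= andbT => x0.
rewrite -EFinM -gig_fun_half_div//; congr EFin.
by field; rewrite !gt_eqF.
Qed.

(* With [u = 1 / x], [1 / sqrt x <= 1 + u <= (1 + 2 / b) * expR (b * u / 2)]. *)
Lemma gig_fun_half_le (b x : R) : 0 < b -> 0 < x ->
  gig_fun 2^-1 1 b x <= (1 + 2 / b) * expR (- (2^-1 * x)).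
Proof.
move=> b0 x0; rewrite gig_fun_half//.
have -> : - (2^-1 * (b / x + x)) = - (b / (2 * x)) + - (2^-1 * x).
  by field; rewrite gt_eqF.
rewrite expRD mulrA ler_pM2r ?expR_gt0// expRN ler_pdivrMr ?expR_gt0//.
have s0 : 0 < (Num.sqrt x)^-1 by rewrite invr_gt0 sqrtr_gt0.
have sE : (Num.sqrt x)^-1 ^+ 2 = x^-1 by rewrite exprVn sqr_sqrtr// ltW.
have h1 : (Num.sqrt x)^-1 <= 1 + x^-1 by rewrite -sE; nra.
have h2 := expR_ge1Dx (b / (2 * x)).
have bx : b / (2 * x) = b / 2 * x^-1 by field; rewrite gt_eqF.
have b20 : 0 < 2 / b by rewrite divr_gt0.
have h3 : x^-1 = 2 / b * (b / (2 * x)) by field; rewrite !gt_eqF.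
have h4 : 0 < b / (2 * x) by rewrite divr_gt0 ?mulr_gt0.
apply: (le_trans h1); rewrite h3; nra.
Qed.

Lemma integral_gig_fun_half_lty (b : R) : 0 < b ->
  (\int[mu]_(x in `]0%R, +oo[) (gig_fun 2^-1 1 b x)%:E < +oo)%E.
Proof.
(* The extra factor 2 cancels the rate 1/2 in front of the exponential density used as dominating
   function. *)
move=> b0; pose C : R := (1 + 2 / b) * 2.
have C0 : 0 <= C by rewrite mulr_ge0// addr_ge0// divr_ge0// ltW.
have mexp : measurable_fun setT (exponential_pdf (2^-1 : R)).
  exact: measurable_exponential_pdf.
apply: (@le_lt_trans _ _
    (\int[mu]_(x in `]0%R, +oo[) (C%:E * (exponential_pdf 2^-1 x)%:E))%E).
  apply: ge0_le_integral => //.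
  - by move=> x _; rewrite lee_fin gig_fun_ge0.
  - by apply/measurable_EFinP; exact: measurable_gig_fun_half.
  - apply: measurable_funTS; apply/measurable_EFinP.
    exact: measurable_funM.
  - move=> x; rewrite /= in_itv/= andbT => x0.
    rewrite -EFinM lee_fin (exponential_pdfE _ (ltW x0)).
    apply: (le_trans (gig_fun_half_le b0 x0)).
    by rewrite /C mulNr mulrA mulfK.
rewrite ge0_integralZl//; last 2 first.
- by apply: measurable_funTS; apply/measurable_EFinP.
- by move=> x _; rewrite lee_fin exponential_pdf_ge0.
apply: lte_mul_pinfty; rewrite ?lee_fin//.
apply: (@le_lt_trans _ _ (\int[mu]_x (exponential_pdf 2^-1 x)%:E)%E).
  apply: ge0_subset_integral => //.
  - exact/measurable_EFinP.
  - by move=> x _; rewrite lee_fin exponential_pdf_ge0.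
by rewrite integral_exponential_pdf// ltry.
Qed.

(** If the integral vanished, the nonnegative integrand would be zero almost everywhere. It is
    positive on the whole half-line, which would then lie in a null set. *)
Lemma integral_gig_fun_half_gt0 (b : R) : 0 < b ->
  (0 < \int[mu]_(x in `]0%R, +oo[) (gig_fun 2^-1 1 b x)%:E)%E.
Proof.
move=> b0; rewrite lt0e integral_ge0 ?andbT; last first.
  by move=> x _; rewrite lee_fin gig_fun_ge0.
apply/eqP => I0.
have : ae_eq mu `](0 : R), +oo[%classic
    (fun x => (gig_fun 2^-1 1 b x)%:E) (cst 0%E).
  apply/ae_eq_integral_abs => //.
    by apply/measurable_EFinP; exact: measurable_gig_fun_half.
  rewrite -[RHS]I0; apply: eq_integral => x _.
  by rewrite gee0_abs// lee_fin gig_fun_ge0.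
move=> [A [mA A0 subA]].
have : (mu `]0%R, +oo[%classic <= mu A)%E.
  apply: le_measure; rewrite ?inE//.
  move=> x x0; apply: subA => /(_ x0) [] /eqP.
  rewrite gt_eqF// gig_fun_half_gt0//.
  by move: x0; rewrite /= in_itv/= andbT.
by rewrite A0 lebesgue_measure_itv/= ltry.
Qed.

Lemma gig_norm_half (b : R) : 0 < b ->
  (gig_norm 2^-1 1 b)%:E =
    (\int[mu]_(x in `]0%R, +oo[) (gig_fun 2^-1 1 b x)%:E)%E.
Proof.
move=> b0; rewrite fineK// ge0_fin_numE ?integral_gig_fun_half_lty//.
exact/ltW/integral_gig_fun_half_gt0.
Qed.

Lemma gig_norm_half_gt0 (b : R) : 0 < b -> 0 < gig_norm 2^-1 1 b.
Proof.
by move=> b0; rewrite -lte_fin gig_norm_half// integral_gig_fun_half_gt0.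
Qed.

Lemma measurable_gig_pdf_half (b : R) :
  measurable_fun setT (gig_pdf 2^-1 1 b).
Proof.
apply: measurable_funM => //; apply/(measurable_restrictT _ _).1 => //.
exact: measurable_gig_fun_half.
Qed.

(** Used with [g = 1] for the total mass and with [g x = x^-1] for the mean of the inverse. *)
Lemma integral_gig_pdf_half (g : R -> R) (b : R) : 0 < b ->
  measurable_fun `](0 : R), +oo[ g -> {in `]0, +oo[, forall x, 0 <= g x} ->
  (\int[mu]_(x in `]0%R, +oo[) ((g x)%:E * (gig_pdf 2^-1 1 b x)%:E) =
   ((gig_norm 2^-1 1 b)^-1)%:E *
     \int[mu]_(x in `]0%R, +oo[) (g x * gig_fun 2^-1 1 b x)%R%:E)%E.
Proof.
move=> b0 mg g0; rewrite -ge0_integralZl//; last 3 first.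
- apply/measurable_EFinP; apply: measurable_funM => //.
  exact: measurable_gig_fun_half.
- by move=> x x0; rewrite lee_fin mulr_ge0 ?gig_fun_ge0// g0.
- by rewrite lee_fin invr_ge0 ltW// gig_norm_half_gt0.
apply: eq_integral => x x0; rewrite -!EFinM /gig_pdf patchE x0.
by congr EFin; rewrite mulrA mulrC.
Qed.

Lemma gig_prob_half_setT (b : R) : 0 < b -> gig_prob 2^-1 1 b setT = 1%E.
Proof.
move=> b0; rewrite /gig_prob.
transitivity (\int[mu]_(x in `]0%R, +oo[) (1%:E * (gig_pdf 2^-1 1 b x)%:E))%E.
  rewrite [RHS]integral_mkcond; apply: eq_integral => x _.
  rewrite patchE mul1e; case: ifPn => //; rewrite /gig_pdf patchE.
  by move=> /negbTE ->; rewrite mul0r.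
rewrite (@integral_gig_pdf_half (cst 1))//.
under eq_integral do rewrite mul1r.
rewrite -gig_norm_half// -EFinM mulVf// gt_eqF//.
exact: gig_norm_half_gt0.
Qed.

Lemma integral_inv_gig_pdf_half (b : R) : 0 < b ->
  (\int[mu]_(x in `]0%R, +oo[) ((x^-1)%:E * (gig_pdf 2^-1 1 b x)%:E) =
   ((Num.sqrt b)^-1)%:E)%E.
Proof.
move=> b0; rewrite (@integral_gig_pdf_half (@GRing.inv R))//; last 2 first.
- apply: measurable_fun_itv0y => x; rewrite in_itv/= andbT => x0.
  by apply: inv_continuous; rewrite lt0r_neq0.
- by move=> x; rewrite in_itv/= andbT => x0; rewrite invr_ge0 ltW.
rewrite integral_inv_gig_fun_half// -gig_norm_half// -!EFinM.
by rewrite mulrCA mulVf ?mulr1// gt_eqF// gig_norm_half_gt0.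
Qed.

End gig.

(** * From the one-dimensional density to expectations under the product law *)

Lemma measurable_inv (R : realType) : measurable_fun [set: R] (@GRing.inv R).
Proof.
(* At 0 both sides are 0, as [0^-1 = 0]. *)
rewrite (_ : GRing.inv = (fun x : R => x * `|x| `^ (- 2%:R))).
  apply: measurable_funM => //.
  apply: (measurableT_comp (measurable_powR _)).
  exact: normr_measurable.
apply/funext => x; rewrite powR_invn// real_normK ?num_real//.
have [->|x0] := eqVneq x 0; first by rewrite invr0 mul0r.
by field.
Qed.

(** The density formula makes [nu] absolutely continuous with respect to [mu]. The Radon-Nikodym
    derivative and [h] have equal integrals over measurable sets, so they agree almost everywhere,
    and the change of variables known for the former passes to [h]. *)
Lemma ge0_integral_density d (T : measurableType d) (R : realType)
    (mu : {sigma_finite_measure set T -> \bar R})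
    (nu : {finite_measure set T -> \bar R}) (h : T -> R) (f : T -> \bar R)
    (D : set T) :
  measurable_fun setT h ->
  (forall A, measurable A -> nu A = \int[mu]_(x in A) (h x)%:E)%E ->
  measurable D -> measurable_fun D f -> (forall x, 0 <= f x)%E ->
  (\int[nu]_(x in D) f x = \int[mu]_(x in D) (f x * (h x)%:E))%E.
Proof.
move=> mh nuE mD mf f0.
have numu : nu `<< mu.
  apply/null_content_dominatesP => A mA A0.
  rewrite nuE// null_set_integral//; apply: measurable_funTS.
  exact/measurable_EFinP.
rewrite -(Radon_Nikodym_SigmaFinite.change_of_variables numu)//.
have mrn := measurable_int _ (Radon_Nikodym_SigmaFinite.f_integrable numu).
apply: ae_eq_integral => //.
- by apply: emeasurable_funM => //; exact: measurable_funTS.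
- apply: emeasurable_funM => //; apply: measurable_funTS.
  exact/measurable_EFinP.
- apply: ae_eqe_mul2l; apply: integral_ae_eq => //.
  + apply: (integrableS measurableT) => //.
    exact: Radon_Nikodym_SigmaFinite.f_integrable.
  + by apply: measurable_funTS; exact/measurable_EFinP.
  + move=> E _ mE; rewrite -nuE//.
    by rewrite -Radon_Nikodym_SigmaFinite.f_integral.
Qed.

(** A cylinder over [A] is the box with [setT] in all other coordinates, whose factors are 1. *)
Lemma is_product_law_marginal (R : realType) (m : nat)
    (mu : set (m.-tuple R) -> \bar R) (nu : 'I_m -> set R -> \bar R)
    (n : 'I_m) (A : set R) :
  is_product_law mu nu -> (forall i, nu i setT = 1%E) -> measurable A ->
  mu [set t | A (tnth t n)] = nu n A.
Proof.
move=> munu nu1 mA; pose B i := if i == n then A else setT.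
have mB i : measurable (B i) by rewrite /B; case: ifP.
have -> : [set t | A (tnth t n)] =
    [set t : m.-tuple R | forall i, B i (tnth t i)].
  apply/seteqP; split=> [t At i|t /(_ n)]; last by rewrite /B eqxx.
  by rewrite /B; case: eqP => // ->.
rewrite munu// (bigD1 n)//= {1}/B eqxx big1 ?mule1// => i /negbTE ni.
by rewrite /B ni.
Qed.

(** The expectation is restricted to the event that coordinate [n] is positive, pushed forward along
    that coordinate, and then written as an integral against the density. *)
Lemma expectation_inv_gig_half (R : realType) (N : nat) (b : 'I_N -> R)
    (q : probability (N.-tuple R) R) (n : 'I_N) :
  (forall i, 0 < b i) ->
  is_product_law q (fun i => gig_prob 2^-1 1 (b i)) ->
  ('E_q[fun lam => ((tnth lam n)^-1)%R] = ((Num.sqrt (b n))^-1)%:E)%E.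
Proof.
move=> b0 hq; pose X (lam : N.-tuple R) : R := tnth lam n.
have mX : measurable_fun setT X by exact: measurable_tnth.
have qX A : measurable A -> q (X @^-1` A) = gig_prob 2^-1 1 (b n) A.
  move=> mA; apply: (is_product_law_marginal n hq) => // i.
  exact: gig_prob_half_setT.
pose D := `](0 : R), +oo[%classic.
have mD : measurable D by exact: measurable_itv.
have mXD : measurable (X @^-1` D).
  by rewrite -[X in measurable X]setTI; exact: mX.
have minvX : measurable_fun setT (fun lam => ((X lam)^-1)%:E).
  by apply/measurable_EFinP; exact: measurableT_comp (@measurable_inv R) mX.
(* The absolute value makes [f] nonnegative everywhere, as integration against a density demands; on
   [D] it changes nothing. *)
pose f (x : R) : \bar R := `|x^-1|%:E.
have mf : measurable_fun setT f.
  apply/measurable_EFinP; apply: (measurableT_comp (@normr_measurable R setT)).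
  exact: measurable_inv.
have mfD : measurable_fun D f by exact: measurable_funTS.
rewrite unlock.
transitivity (\int[q]_(lam in X @^-1` D) (f \o X) lam)%E.
  rewrite [RHS]integral_mkcond; apply: ae_eq_integral => //.
    by apply/(measurable_restrictT _ _).1 => //; apply: measurable_funTS;
      exact: measurableT_comp.
  (* The density is zero off [D], so the only event on which the integrands may differ is null under
     [q]. *)
  exists (X @^-1` (~` D)); split.
  - by rewrite preimage_setC; exact: measurableC.
  - rewrite [LHS]qX; last exact: measurableC.
    rewrite /gig_prob integral0_eq// => x Dx.
    by rewrite /gig_pdf patchE memNset// mul0r.
  - move=> lam /= h Dlam; apply: h => _; rewrite patchE mem_set//.
    move: Dlam; rewrite /f/= /D/= in_itv/= andbT => Dlam.
    by rewrite ger0_norm// invr_ge0 ltW.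
(* [lebesgue_measure] lives on [measurableTypeR R], which has the same
   measurable sets as [R] but another display. *)
pose X' : N.-tuple R -> measurableTypeR R := X.
have mX' : measurable_fun setT X' by exact: mX.
pose mXfun := isMeasurableFun.Build _ _ _ _ X' mX'.
pose Xrv : {RV q >-> measurableTypeR R} := HB.pack X' mXfun.
transitivity (\int[distribution q Xrv]_(x in D) f x)%E.
  rewrite ge0_integral_pushforward// => x _.
  by rewrite lee_fin.
have f0 x : (0 <= f x)%E by rewrite lee_fin.
have := @ge0_integral_density _ _ R lebesgue_measure (distribution q Xrv)
  (gig_pdf 2^-1 1 (b n)) f D (@measurable_gig_pdf_half R (b n)) qX mD mfD f0.
move=> ->; rewrite -integral_inv_gig_pdf_half//; apply: eq_integral => x.
rewrite inE /D/= in_itv/= andbT => x0.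
by rewrite /f ger0_norm// invr_ge0 ltW.
Qed.

(** * Square-integrability of linear functionals of the corrupted features *)

Section second_moment.
Context d (T : measurableType d) (R : realType) (P : probability T R).
Local Open Scope ereal_scope.

Lemma Lfun2P (f : T -> R) : measurable_fun [set: T] f ->
  'E_P[fun t => (f t ^+ 2)%R] < +oo -> f \in Lfun P 2%:E.
Proof.
rewrite unlock => mf fley; rewrite inE; apply/andP; split; rewrite inE//=.
rewrite /finite_norm unlock poweR_lty//.
under eq_integral => x _ do rewrite /= powR_mulrn// real_normK ?num_real//.
exact: fley.
Qed.

(** Square-integrable functions form a vector space, so second moments of the coordinates control
    every linear combination. *)
Lemma Lfun2_dotv (D : nat) (X : {RV P >-> D.-tuple R}) (w : 'rV[R]_D) :
  (forall i, 'E_P[fun t => (tnth (X t) i ^+ 2)%R] < +oo) ->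
  (fun t => dotv w (rvec (X t))) \in Lfun P 2%:E.
Proof.
move=> X2; have -> : (fun t => dotv w (rvec (X t))) =
    (\sum_(i < D) (w ord0 i *: (fun t => tnth (X t) i)))%R.
  apply/funext => t; rewrite /dotv fct_sumE; apply: eq_bigr => i _.
  by rewrite mxE.
have le12 : (1 <= 2%:E :> \bar R) by rewrite lee1n.
apply: rpred_sum => i _; apply: rpredZ; apply: Lfun2P => //.
apply: (measurableT_comp (measurable_tnth i)).
exact: measurable_funPT.
Qed.

Lemma expectation_affine (Y : T -> R) (a k : R) : Y \in Lfun P 1 ->
  'E_P[fun t => (a * Y t + k)%R] = a%:E * 'E_P[Y] + k%:E.
Proof.
move=> Y1; rewrite -expectationZl// -[in RHS](expectation_cst P k).
rewrite -expectationD ?Lfun_cst//; last by rewrite Lfun_scale.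
by congr expectation; apply/funext => t /=; rewrite mulrC.
Qed.

End second_moment.

(** * Comparison of the two objectives *)

Lemma eq_is_minimizer_addr (R : realType) (W : Type) (F G : W -> \bar R)
    (k : R) : (forall w, F w = G w + k%:E)%E ->
  forall w, is_minimizer F w <-> is_minimizer G w.
Proof.
(* As [k] is real, it cancels from the inequality even at infinite values of [G]. *)
by move=> FG w; split=> + w' => /(_ w'); rewrite !FG leeD2rE.
Qed.

(** The quadratic [c * z + c ^+ 2 / 2 * g * z ^+ 2] has its vertex at [z = - (c * g)^-1], with value
    [- (2 * g)^-1]. Solving [zeta = - (c * g)^-1] for [dotv w v], with [y ^+ 2 = 1], yields the
    shifted label. *)
Lemma zeta_complete_square (R : realType) (D : nat) (c l y g : R)
    (w v : 'rV[R]_D) : c != 0 -> g != 0 -> y = 1 \/ y = -1 ->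
  c * zeta l y w v + c ^+ 2 / 2 * g * zeta l y w v ^+ 2 =
  c ^+ 2 / 2 * g * (dotv w v - (l + (c * g)^-1) * y) ^+ 2 + - (2 * g)^-1.
Proof. by move=> c0 g0 [->|->]; rewrite /zeta; field; rewrite c0 g0. Qed.

Theorem lemma1 (R : realType) (N D : nat)
    (c l : R) (hc : 0 < c) (hl : 1 <= l)
    (x : 'I_N -> 'rV[R]_D)
    (y : 'I_N -> R) (hy : forall n, y n = 1 \/ y n = -1)
    (* corrupting distribution: p n d u is the law p( . | x_nd = u) *)
    (p : 'I_N -> 'I_D -> R -> probability R R)
    (dT : measure_display) (T : measurableType dT) (P : probability T R)
    (Xt : 'I_N -> {RV P >-> D.-tuple R})
    (hlaw : forall n,
      is_product_law (distribution P (Xt n)) (fun d => p n d (x n 0 d)))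
    (hmom2 : forall n (d : 'I_D), ('E_P[fun t => (tnth (Xt n t) d ^+ 2)%R] < +oo)%E)
    (hmean : forall n (d : 'I_D),
      'E_P[fun t => tnth (Xt n t) d]%E = (x n 0 d)%:E)
    (wbar : 'rV[R]_D)
    (hwbar : forall n,
      (0 < 'E_P[fun t => (zeta l (y n) wbar (rvec (Xt n t)) ^+ 2)%R])%E)
    (q : probability (N.-tuple R) R) :
  let m2 (n : 'I_N) : R :=
    fine 'E_P[fun t => (zeta l (y n) wbar (rvec (Xt n t)) ^+ 2)%R]%E in
  forall hq : is_product_law q (fun n => gig_prob 2^-1 1 (c ^+ 2 * m2 n)),
  let gamma (n : 'I_N) : R := fine 'E_q[fun lam => ((tnth lam n)^-1)%R]%E in
  let yh (n : 'I_N) : R := (l + (c * gamma n)^-1) * y n in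
  let M_step (w : 'rV[R]_D) : \bar R :=
    ((sqnorm2 w)%:E + \sum_(n < N)
       'E_P[fun t => (c * zeta l (y n) w (rvec (Xt n t)) +
              c ^+ 2 / 2 * gamma n * zeta l (y n) w (rvec (Xt n t)) ^+ 2)%R])%E in
  let reweighted_loss (w : 'rV[R]_D) : \bar R :=
    ((sqnorm2 w)%:E + (c ^+ 2 / 2)%:E * \sum_(n < N)
       (gamma n)%:E * 'E_P[fun t => ((dotv w (rvec (Xt n t)) - yh n) ^+ 2)%R])%E in
  (forall w, is_minimizer M_step w <-> is_minimizer reweighted_loss w) /\
  (forall n, 'E_q[fun lam => ((tnth lam n)^-1)%R]%E = (gamma n)%:E /\
             gamma n = (c * Num.sqrt (m2 n))^-1).
Proof.
move=> m2 hq gamma yh M_step reweighted_loss.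
(* The free shift [k] serves twice: [l * y n] for [m2 n], and [yh n] for the re-weighted loss. *)
have L2 n w k : (fun t => dotv w (rvec (Xt n t)) - k) \in Lfun P 2%:E.
  have le12 : (1 <= 2%:E :> \bar R)%E by rewrite lee1n.
  by apply: rpredB; [exact: Lfun2_dotv|exact: Lfun_cst].
have L1 n w k : (fun t => (dotv w (rvec (Xt n t)) - k) ^+ 2) \in Lfun P 1.
  by rewrite Lfun1_integrable; exact: (Lfun2_integrable_sqr (L2 n w k)).
have m2E n : 'E_P[fun t => (zeta l (y n) wbar (rvec (Xt n t)) ^+ 2)%R]%E =
    (m2 n)%:E.
  rewrite fineK// expectation_fin_num//.
  (* As [y n] is a sign, [zeta] equals [dotv w v - l * y n] up to sign, and the squares agree. *)
  rewrite (_ : (fun t => _) =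
      (fun t => (dotv wbar (rvec (Xt n t)) - l * y n) ^+ 2))//.
  by apply/funext => t; rewrite /zeta; case: (hy n) => ->; ring.
have m20 n : 0 < m2 n by rewrite -lte_fin -m2E.
have Einv n : 'E_q[fun lam => ((tnth lam n)^-1)%R]%E =
    ((c * Num.sqrt (m2 n))^-1)%:E.
  rewrite (expectation_inv_gig_half n _ hq) => [|i]; last first.
    by rewrite mulr_gt0 ?exprn_gt0.
  by rewrite sqrtrM ?sqr_ge0// sqrtr_sqr gtr0_norm.
have gammaE n : gamma n = (c * Num.sqrt (m2 n))^-1 by rewrite /gamma Einv.
(* Completing the square divides by [gamma n]. *)
have gamma0 n : gamma n != 0.
  by rewrite gammaE invr_neq0// mulf_neq0 ?gt_eqF// sqrtr_gt0.
split; last by move=> n; rewrite gammaE Einv.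
pose k : R := \sum_(n < N) - (2 * gamma n)^-1.
apply: (@eq_is_minimizer_addr _ _ _ _ k) => w.
pose e n := 'E_P[fun t => ((dotv w (rvec (Xt n t)) - yh n) ^+ 2)%R]%E.
(* Finiteness of each [e n] moves the comparison of the objectives from extended reals to [R]. *)
have eE n : e n = (fine (e n))%:E by rewrite fineK// expectation_fin_num.
have ME n : 'E_P[fun t => (c * zeta l (y n) w (rvec (Xt n t)) +
      c ^+ 2 / 2 * gamma n * zeta l (y n) w (rvec (Xt n t)) ^+ 2)%R]%E =
    (c ^+ 2 / 2 * gamma n * fine (e n) + - (2 * gamma n)^-1)%:E.
  under eq_fun => t do rewrite (zeta_complete_square _ _ _ (lt0r_neq0 hc)
    (gamma0 n) (hy n)).
  by rewrite expectation_affine// -/(e n) eE.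
rewrite /M_step /reweighted_loss.
under eq_bigr do rewrite ME.
under [in RHS]eq_bigr do rewrite -/(e _) eE -EFinM.
rewrite !sumEFin -EFinM -!EFinD -addrA /k mulr_sumr -big_split/=.
by congr (_ + _)%:E; apply: eq_bigr => n _; rewrite mulrA.
Qed.
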